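(* The $2$-Steiner system $\mathcal{S}_A(2,S_7)$ in $S_7$ determines the configuration of $A_1^8(2)$-polytopes in $4_{21}$ with a fixed center and the configuration of $A_1^7(2)$-polytopes in $3_{21}$.
   Context: For $r=7,8$, $S_r$ is a del Pezzo surface (smooth, $-K_{S_r}$ ample) obtained by blowing up $\mathbb{P}^2$ at $r$ points, with canonical class $K_{S_r}$. A line is a class $l\in\mathrm{Pic}\,S_r$ with $l^2=l\cdot K_{S_r}=-1$; $L_r$ is the set of lines, which is the vertex set of the Gosset polytope $(r-4)_{21}$ (the convex hull of $L_r$ in $\mathrm{Pic}\,S_r\otimes\mathbb{Q}$). An $A_1^r(2)$-polytope (inscribed $2$-degree $1$-simplex) in $(r-4)_{21}$ is given by two lines $l_1,l_2\in L_r$ with $l_1\cdot l_2=2$; its center is $l_1+l_2$. The configuration of a class of such polytopes (for instance those with a fixed center) is the family of sets of lines forming them; a configuration on $S_8$ is compared with a family of sets of lines on $S_7$ by blowing down a line. A $k$-Steiner system on $S_r$ is a family of sets of $k$ lines in $\mathrm{Pic}\,S_r$ where each $k-1$ lines with constant intersection to each other determine exactly one set of the family. $\mathcal{S}_A(2,S_7)$ is the family of all sets $\{l_1,l_2\}\subset L_7$ with $l_1\cdot l_2=2$; here every line of $L_7$ determines exactly one such pair. *)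

(* Defs.v *)
From mathcomp Require Import all_boot all_order all_algebra finmap.
From mathcomp Require Import boolp classical_sets.

Import Order.TTheory GRing.Theory Num.Theory.

Local Open Scope classical_set_scope.
Local Open Scope ring_scope.

(* Pic S_r for S_r the blow-up of P^2 at r points: the free abelian group on   *)
(* h, e_1, ..., e_r, where h is the pullback of the class of a line of P^2 and *)
(* e_i is the i-th exceptional class. Column 0 is the coefficient of h, column *)
(* i is that of e_i. The lattice, its form and its canonical class depend only *)
(* on r, not on the position of the blown-up points.                           *)
Notation Pic r := 'rV[int]_(r.+1).

(* h.h = 1, e_i.e_i = -1, all other products of basis elements being 0. *)
Definition dot {r : nat} (D E : Pic r) : int :=
  D 0 0 * E 0 0 - \sum_(i < r) D 0 (lift 0 i) * E 0 (lift 0 i).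

(* K = -3h + e_1 + ... + e_r *)
Definition canonical_class (r : nat) : Pic r := \row_i (if i == 0 then - 3 else 1).

Definition line (r : nat) : set (Pic r) :=
  [set l | dot l l = - 1 /\ dot l (canonical_class r) = - 1].

Notation PicQ r := 'rV[rat]_(r.+1).

Definition toQ {r : nat} (D : Pic r) : PicQ r := map_mx intr D.

Definition hull {V : lmodType rat} (S : set V) : set V :=
  [set x | exists (n : nat) (w : 'I_n -> rat) (v : 'I_n -> V),
     [/\ forall i, 0 <= w i, \sum_i w i = 1, forall i, S (v i)
       & x = \sum_i w i *: v i]].

(* The Gosset polytope (r-4)_{21}, whose vertex set is the set of lines. *)
Definition gosset (r : nat) : set (PicQ r) := hull (toQ @` line r).

Definition A1_simplex {r : nat} (l1 l2 : Pic r) (P : set (PicQ r)) : Prop :=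
  [/\ line r l1, line r l2, dot l1 l2 = 2,
      P = hull (toQ @` [set l1; l2]) & P `<=` gosset r].

Definition A1_polytopes (r : nat) : set (set (PicQ r)) :=
  [set P | exists l1 l2 : Pic r, A1_simplex l1 l2 P].

(* By convention the center of the polytope given by l1, l2 is the class       *)
(* l1 + l2, not the barycenter (l1 + l2) / 2.                                  *)
Definition A1_polytopes_at {r : nat} (c : Pic r) : set (set (PicQ r)) :=
  [set P | exists l1 l2 : Pic r, A1_simplex l1 l2 P /\ l1 + l2 = c].

Definition configuration {r : nat} (C : set (set (PicQ r))) :
    set {fset Pic r} :=
  [set A | [set` A] `<=` line r /\ C (hull (toQ @` [set` A]))].

Definition steiner_system (k : nat) {r : nat} (F : set {fset Pic r}) : Prop :=
  (forall A, F A -> [set` A] `<=` line r /\ #|` A| = k) /\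
  (forall B : {fset Pic r}, [set` B] `<=` line r -> #|` B| = k.-1 ->
     (exists m : int, forall x y, x \in B -> y \in B -> x != y ->
        dot x y = m) ->
     exists! A : {fset Pic r}, F A /\ (B `<=` A)%fset).

Definition S_A2 (r : nat) : set {fset Pic r} :=
  [set A | exists l1 l2 : Pic r,
     [/\ line r l1, line r l2, dot l1 l2 = 2 & A = [fset l1; l2]%fset]].

(* Blowing down a line l of S_{r+1} is a contraction f : S_{r+1} -> S_r with   *)
(* exceptional curve l. It is recorded by p = f^* : Pic S_r -> Pic S_{r+1}:    *)
(* p preserves intersection numbers, K_{S_{r+1}} = p K_{S_r} + l, and          *)
(* Pic S_{r+1} is the orthogonal sum of the image of p and of Z l.             *)
Definition blow_down {r : nat} (l : Pic r.+1)
    (p : {additive Pic r -> Pic r.+1}) : Prop :=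
  [/\ forall D E, dot (p D) (p E) = dot D E,
      canonical_class r.+1 = p (canonical_class r) + l,
      forall D, dot (p D) l = 0
    & forall D, exists (E : Pic r) (m : int), D = p E + m *: l].

Definition pullback_family {r : nat} (p : {additive Pic r -> Pic r.+1})
    (F : set {fset Pic r}) : set {fset Pic r.+1} :=
  [set [fset p x | x in A]%fset | A in F].

(* Main.v *)
Require Import Defs.
From HB Require Import structures.
From mathcomp Require Import all_boot all_order all_algebra finmap.
From mathcomp Require Import boolp classical_sets.
From mathcomp Require Import zify.
Import Order.TTheory GRing.Theory Num.Theory.
Local Open Scope classical_set_scope.
Local Open Scope ring_scope.

(** The intersection form is negative definite on the orthogonal of K for
    r <= 8 ([dot_orthK]), and the whole theorem rests on this.

    On S_7, two lines with l1 . l2 = 2 satisfy l1 + l2 = - K, because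
    l1 + l2 + K is orthogonal to K and has square 0. Each line l therefore has
    exactly one partner, its image - K - l under the Geiser involution, which
    gives the Steiner system.

    Distinct lines have intersection at least 0, whereas l . l = - 1; thus
    D |-> D . l supports the Gosset polytope at the vertex l, and a set of lines
    can be recovered from its convex hull ([hull_lines_inj]). Configurations of
    polytopes thereby reduce to families of pairs of lines, on S_7 and on S_8.

    On S_8, let c = l1 + l2 be a center. Then l = c + K is a line orthogonal to
    l1 and l2, and the equation l1 + l2 = c reads l1 + l2 = l - K. Since - K_7
    pulls back to l - K_8 when l is blown down, the pairs of center c are the
    pullbacks of the pairs of S_7, all of which have center - K_7
    ([configuration_pullback]).

    Finally each line l of S_8 can be blown down ([line8_contractible]). This is
    immediate for e_8, and reflections in roots, which are isometries fixing K,
    carry the property from line to line. A line l' goes to l in one reflection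
    when l' . l = 0, and the Bertini involution l' |-> - 2K - l' turns larger
    intersections into 2 - l' . l. Only l' . l = 1 is out of direct reach, and
    no line meets every e_i exactly once. *)

(** * The intersection form *)

Lemma dotC {r : nat} (D E : Pic r) : dot D E = dot E D.
Proof.
by rewrite /dot mulrC; congr (_ - _); apply: eq_bigr => i _; rewrite mulrC.
Qed.

Lemma dotDl {r : nat} (D D' E : Pic r) : dot (D + D') E = dot D E + dot D' E.
Proof.
rewrite /dot mxE mulrDl; under eq_bigr do rewrite mxE mulrDl.
by rewrite big_split opprD addrACA.
Qed.

Lemma dotZl {r : nat} (m : int) (D E : Pic r) : dot (m *: D) E = m * dot D E.
Proof.
rewrite /dot mxE -mulrA; under eq_bigr do rewrite mxE -mulrA.
by rewrite -mulr_sumr mulrBr.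
Qed.

Lemma dotNl {r : nat} (D E : Pic r) : dot (- D) E = - dot D E.
Proof. by rewrite -scaleN1r dotZl mulN1r. Qed.

Lemma dotDr {r : nat} (D E E' : Pic r) : dot D (E + E') = dot D E + dot D E'.
Proof. by rewrite dotC dotDl ![dot _ D]dotC. Qed.

Lemma dotZr {r : nat} (m : int) (D E : Pic r) : dot D (m *: E) = m * dot D E.
Proof. by rewrite dotC dotZl dotC. Qed.

Lemma dotNr {r : nat} (D E : Pic r) : dot D (- E) = - dot D E.
Proof. by rewrite dotC dotNl dotC. Qed.

Definition dotE := (@dotDl, @dotDr, @dotNl, @dotNr, @dotZl, @dotZr).

Lemma dot_canonical {r : nat} (D : Pic r) :
  dot D (canonical_class r) = - (3 * D 0 0 + \sum_(i < r) D 0 (lift 0 i)).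
Proof.
rewrite /dot mxE /=; under eq_bigr do rewrite mxE /= mulr1.
by rewrite mulrN mulrC -opprD.
Qed.

Lemma dot_canonicalK (r : nat) :
  dot (canonical_class r) (canonical_class r) = 9 - r%:Z.
Proof.
rewrite dot_canonical mxE /=; under eq_bigr do rewrite mxE /=.
rewrite sumr_const card_ord; lia.
Qed.

(** Writing D = d h + sum x_i e_i, orthogonality to K reads sum x_i = - 3 d, so
    sum (3 x_i + d)^2 = 9 sum x_i^2 - 18 d^2 + r d^2. This single identity gives
    the negativity of the form on the orthogonal of K for r <= 9, and its
    definiteness for r <= 8. *)
Lemma dot_orthK {r : nat} (D : Pic r) :
  dot D (canonical_class r) = 0 ->
  - (9 * dot D D) = \sum_(i < r) (3 * D 0 (lift 0 i) + D 0 0) ^+ 2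
                    + (9 - r%:Z) * D 0 0 ^+ 2.
Proof.
rewrite dot_canonical => /eqP; rewrite oppr_eq0 addrC addr_eq0 => /eqP sumD.
have -> : \sum_(i < r) (3 * D 0 (lift 0 i) + D 0 0) ^+ 2 =
    9 * \sum_(i < r) D 0 (lift 0 i) * D 0 (lift 0 i)
    + 6 * D 0 0 * \sum_(i < r) D 0 (lift 0 i) + r%:Z * D 0 0 ^+ 2.
  rewrite !mulr_sumr -big_split /=.
  have -> : r%:Z * D 0 0 ^+ 2 = \sum_(i < r) D 0 0 ^+ 2.
    by rewrite sumr_const card_ord -mulr_natl natz.
  by rewrite -big_split /=; apply: eq_bigr => i _; lia.
by rewrite sumD /dot; lia.
Qed.

Lemma dot_orthK_le0 {r : nat} (D : Pic r) : (r <= 9)%N ->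
  dot D (canonical_class r) = 0 -> dot D D <= 0.
Proof.
move=> r9 /dot_orthK DD.
have : 0 <= - (9 * dot D D).
  rewrite DD addr_ge0 ?sumr_ge0 // => [i _|]; first exact: sqr_ge0.
  by rewrite mulr_ge0 ?sqr_ge0 //; lia.
lia.
Qed.

Lemma dot_orthK_eq0 {r : nat} (D : Pic r) : (r <= 8)%N ->
  dot D (canonical_class r) = 0 -> dot D D = 0 -> D = 0.
Proof.
move=> r8 /dot_orthK DD D0; move: DD; rewrite D0 mulr0 oppr0 => /esym/eqP.
have sq_ge0 (i : 'I_r) : true -> 0 <= (3 * D 0 (lift 0 i) + D 0 0) ^+ 2.
  by rewrite sqr_ge0.
have r9 : 0 < 9 - r%:Z by lia.
rewrite paddr_eq0; last 2 first.
- exact: sumr_ge0.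
- by rewrite mulr_ge0 ?sqr_ge0 ?ltW.
rewrite psumr_eq0 // => /andP[/allP sq0].
rewrite mulf_eq0 gt_eqF //= sqrf_eq0 => /eqP D00.
apply/rowP => j; rewrite mxE; case: (unliftP 0 j) => [i ->|-> //].
have := sq0 i; rewrite mem_index_enum D00 addr0 sqrf_eq0 => /(_ isT); lia.
Qed.

(** * Lines *)

(** The difference of two lines is orthogonal to K, and its square
    - 2 - 2 l . l' is then at most 0; it vanishes only when l . l' = - 1. *)
Lemma line_dot_ge {r : nat} (l l' : Pic r) : (r <= 8)%N ->
  line r l -> line r l' -> - 1 <= dot l l'.
Proof.
move=> r8 [ll lK] [ll' lK'].
have := @dot_orthK_le0 r (l - l') (leqW r8).
rewrite !dotE (dotC l' l); lia.
Qed.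

Lemma line_dot_eqN1 {r : nat} (l l' : Pic r) : (r <= 8)%N ->
  line r l -> line r l' -> dot l l' = - 1 -> l = l'.
Proof.
move=> r8 [ll lK] [ll' lK'] d; apply/eqP; rewrite -subr_eq0; apply/eqP.
by apply: dot_orthK_eq0 => //; rewrite !dotE ?(dotC l' l); lia.
Qed.

(** As K^2 = 2, the class l1 + l2 + K is orthogonal to K and has square
    2 - 4 + 2 = 0. *)
Lemma line7_dot2 (l1 l2 : Pic 7) : line 7 l1 -> line 7 l2 -> dot l1 l2 = 2 ->
  l1 + l2 = - canonical_class 7.
Proof.
move=> [l11 l1K] [l22 l2K] d; apply/eqP; rewrite -addr_eq0; apply/eqP.
have KK := dot_canonicalK 7.
apply: dot_orthK_eq0 => //; rewrite !dotE ?(dotC l2 l1)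
  ?(dotC (canonical_class 7) l1) ?(dotC (canonical_class 7) l2); lia.
Qed.

Lemma geiser_line (l : Pic 7) : line 7 l ->
  line 7 (- canonical_class 7 - l) /\ dot l (- canonical_class 7 - l) = 2.
Proof.
move=> [ll lK]; have KK := dot_canonicalK 7.
by split; [split|]; rewrite !dotE ?(dotC (canonical_class 7) l); lia.
Qed.

Lemma S_A2_steiner : steiner_system 2 (S_A2 7).
Proof.
split=> [_ [l1 [l2 [l1L l2L d ->]]]|B BL /eqP/cardfs1P[l Bl] _].
  split=> [x /=|]; first by rewrite !inE => /orP[]/eqP->.
  by rewrite cardfs2; case: eqP => // l12; case: l1L; rewrite {2}l12 d.
have lL : line 7 l by apply: BL; rewrite Bl /= inE.
have [l'L d] := geiser_line l lL.
exists [fset l; - canonical_class 7 - l]%fset; split.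
  split; first by exists l, (- canonical_class 7 - l).
  by rewrite Bl fsub1set !inE eqxx.
move=> _ [[l1 [l2 [l1L l2L d12 ->]]]].
have s := line7_dot2 _ _ l1L l2L d12.
rewrite Bl fsub1set !inE -s => /orP[]/eqP->; last rewrite fsetUC.
  by rewrite addrC addKr.
by rewrite addrK.
Qed.

(** * Polytopes spanned by lines *)

Lemma sub_hull {V : lmodType rat} (S T : set V) : S `<=` T -> hull S `<=` hull T.
Proof. by move=> ST x [n [w [v [w0 w1 Sv ->]]]]; exists n, w, v; split; auto. Qed.

Lemma mem_hull {V : lmodType rat} (S : set V) (x : V) : S x -> hull S x.
Proof.
move=> Sx; exists 1%N, (fun=> 1), (fun=> x); split=> //.
  by rewrite big_ord1.
by rewrite big_ord1 scale1r.
Qed.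

(** The column of the linear form D |-> D . l, extended to rational classes. *)
Definition dual_col {r : nat} (l : Pic r) : 'cV[rat]_(r.+1) :=
  \col_j (if j == 0 then l 0 j else - l 0 j)%:~R.

Lemma toQ_dual_col {r : nat} (D l : Pic r) :
  (toQ D *m dual_col l) 0 0 = (dot D l)%:~R.
Proof.
rewrite mxE big_ord_recl !mxE /= /dot rmorphB rmorphM rmorph_sum -sumrN /=.
by congr (_ + _); apply: eq_bigr => i _; rewrite !mxE /= -rmorphM /= mulrN rmorphN.
Qed.

(** Intersection with l is a linear form that is - 1 at l and at least 0 at
    every other line: a convex combination of lines can reach the value - 1
    only if l itself occurs in it. *)
Lemma line_in_hull {r : nat} (l : Pic r) (S : set (Pic r)) : (r <= 8)%N ->
  line r l -> S `<=` line r -> hull (toQ @` S) (toQ l) -> S l.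
Proof.
move=> r8 lL SL [n [w [v [w0 w1 Sv lv]]]].
(* The form shifted by 1 is nonnegative on lines; its weighted sum vanishes, *)
(* hence so does each term. *)
have sum0 : \sum_i w i * ((v i *m dual_col l) 0 0 + 1) = 0.
  under eq_bigr do rewrite mulrDr mulr1.
  rewrite big_split /= w1.
  suff -> : \sum_i w i * (v i *m dual_col l) 0 0 = - 1 by rewrite addNr.
  transitivity ((toQ l *m dual_col l) 0 0).
    rewrite lv mulmx_suml summxE; apply: eq_bigr => i _.
    by rewrite -scalemxAl [RHS]mxE.
  by rewrite toQ_dual_col lL.1.
have term_ge0 i : 0 <= w i * ((v i *m dual_col l) 0 0 + 1).
  rewrite mulr_ge0 //; case: (Sv i) => u Su <-.
  rewrite toQ_dual_col -(rmorphD _ _ 1) ler0z.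
  by have := line_dot_ge _ _ r8 (SL _ Su) lL; lia.
have [i wi] : exists i, w i != 0.
  apply/existsP; apply: contraT; rewrite negb_exists => /forallP wn.
  have /eqP := w1; rewrite big1 // => i _.
  by apply/eqP; have := wn i; rewrite negbK.
have /eqP := sum0; rewrite psumr_eq0 // => /allP/(_ i).
rewrite mem_index_enum => /(_ isT); rewrite mulf_eq0 (negbTE wi) /=.
case: (Sv i) => u Su <-; rewrite toQ_dual_col -(rmorphD _ _ 1) intr_eq0 => /eqP d.
suff <- : u = l by [].
by apply: line_dot_eqN1 (SL _ Su) lL _ => //; lia.
Qed.

Lemma hull_lines_inj {r : nat} (S T : set (Pic r)) : (r <= 8)%N ->
  S `<=` line r -> T `<=` line r -> hull (toQ @` S) = hull (toQ @` T) -> S = T.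
Proof.
move=> r8 SL TL ST; rewrite eqEsubset; split=> l lS.
  by apply: line_in_hull (SL _ lS) TL _ => //; rewrite -ST; apply/mem_hull; exists l.
by apply: line_in_hull (TL _ lS) SL _ => //; rewrite ST; apply/mem_hull; exists l.
Qed.

Lemma set_fset2 {K : choiceType} (x y : K) : [set` [fset x; y]%fset] = [set x; y].
Proof. by rewrite set_fsetU1 set_fset1. Qed.

Lemma imfset2 {K K' : choiceType} (f : K -> K') (x y : K) :
  [fset f z | z in [fset x; y]]%fset = [fset f x; f y]%fset.
Proof.
apply/fsetP => z; rewrite !inE; apply/imfsetP/orP => [[u /=]|[]/eqP->].
- by rewrite !inE => /orP[]/eqP-> ->; [left|right].
- by exists x => //=; rewrite !inE eqxx.
- by exists y => //=; rewrite !inE eqxx orbT.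
Qed.

(** The set of lines in a configuration is determined by the polytope, since
    lines are vertices. *)
Lemma A1_simplex_lines {r : nat} (l1 l2 : Pic r) (A : {fset Pic r}) :
  (r <= 8)%N -> [set` A] `<=` line r ->
  A1_simplex l1 l2 (hull (toQ @` [set` A])) -> A = [fset l1; l2]%fset.
Proof.
move=> r8 AL [l1L l2L _ h _].
have Al : [set` A] = [set l1; l2].
  by apply: hull_lines_inj h => // x [] ->.
rewrite -set_fset2 in Al; apply/fsetP => x.
by have /= := congr1 (@^~ x) Al; apply: is_true_inj.
Qed.

Lemma pair_A1_simplex {r : nat} (l1 l2 : Pic r) :
  line r l1 -> line r l2 -> dot l1 l2 = 2 ->
  [set` [fset l1; l2]%fset] `<=` line r /\
  A1_simplex l1 l2 (hull (toQ @` [set` [fset l1; l2]%fset])).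
Proof.
move=> l1L l2L d; have L : [set l1; l2] `<=` line r by move=> x [] ->.
rewrite set_fset2; split=> //; split=> //.
exact/sub_hull/image_subset.
Qed.

Lemma configuration_A1 (r : nat) : (r <= 8)%N ->
  configuration (A1_polytopes r) = S_A2 r.
Proof.
move=> r8; rewrite eqEsubset; split=> A.
  move=> [AL [l1 [l2 s]]]; exists l1, l2.
  by have := A1_simplex_lines _ _ _ r8 AL s; case: s.
move=> [l1 [l2 [l1L l2L d ->]]].
have [L s] := pair_A1_simplex _ _ l1L l2L d.
by split=> //; exists l1, l2.
Qed.

Lemma configuration_A1_at {r : nat} (c : Pic r) (A : {fset Pic r}) :
  (r <= 8)%N ->
  configuration (A1_polytopes_at c) A <->
  exists l1 l2 : Pic r, [/\ line r l1, line r l2, dot l1 l2 = 2, l1 + l2 = c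
                          & A = [fset l1; l2]%fset].
Proof.
move=> r8; split.
  move=> [AL [l1 [l2 [s lc]]]]; exists l1, l2.
  by have := A1_simplex_lines _ _ _ r8 AL s; case: s.
move=> [l1 [l2 [l1L l2L d lc ->]]].
have [L s] := pair_A1_simplex _ _ l1L l2L d.
by split=> //; exists l1, l2.
Qed.

(** * Reflections and blow-downs *)

(** The form being negative on roots (a . a = - 2), the orthogonal reflection
    x - 2 (x . a) / (a . a) a has a plus sign here. *)
Definition reflection {r : nat} (a x : Pic r) : Pic r := x + dot x a *: a.

Lemma reflection_is_linear {r : nat} (a : Pic r) : linear (reflection a).
Proof.
by move=> m x y; rewrite /reflection !dotE scalerDl scalerDr scalerA addrACA.
Qed.

HB.instance Definition _ (r : nat) (a : Pic r) :=
  GRing.isLinear.Build int (Pic r) (Pic r) _ (reflection a)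
    (reflection_is_linear a).

Definition root {r : nat} (a : Pic r) : Prop :=
  dot a a = - 2 /\ dot a (canonical_class r) = 0.

Lemma reflection_dot {r : nat} (a x y : Pic r) : root a ->
  dot (reflection a x) (reflection a y) = dot x y.
Proof. by move=> [aa _]; rewrite !dotE aa (dotC a y); lia. Qed.

Lemma reflectionK {r : nat} (a : Pic r) : root a -> involutive (reflection a).
Proof.
move=> [aa _] x; rewrite /reflection !dotE aa -addrA -scalerDl.
by rewrite [X in X *: a](_ : _ = 0) ?scale0r ?addr0 //; lia.
Qed.

Lemma reflection_canonical {r : nat} (a : Pic r) : root a ->
  reflection a (canonical_class r) = canonical_class r.
Proof. by move=> [_ aK]; rewrite /reflection dotC aK scale0r addr0. Qed.

Lemma reflection_blow_down {r : nat} (l a : Pic r.+1)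
    (p : {additive Pic r -> Pic r.+1}) :
  root a -> blow_down l p -> blow_down (reflection a l) (reflection a \o p).
Proof.
move=> ra [pd pK pl pdec]; split=> [D E||D|D] /=.
- by rewrite reflection_dot.
- by rewrite -(reflection_canonical a ra) {1}pK linearD.
- by rewrite reflection_dot.
- have [E [m Em]] := pdec (reflection a D); exists E, m.
  by rewrite -[LHS](reflectionK a ra) Em linearD linearZ.
Qed.

Definition contractible {r : nat} (l : Pic r.+1) : Prop :=
  exists p : {additive Pic r -> Pic r.+1}, blow_down l p.

Lemma contractible_reflection {r : nat} (a l l' : Pic r.+1) :
  root a -> reflection a l' = l -> contractible l' -> contractible l.
Proof. by move=> ra <- [p bp]; exists (reflection a \o p); apply: reflection_blow_down. Qed.

(** Two disjoint lines are exchanged by the reflection in their difference,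
    which is then a root; negative intersection forces equality. *)
Lemma contractible_dot_le0 {r : nat} (l l' : Pic r.+1) : (r < 8)%N ->
  line r.+1 l -> line r.+1 l' -> dot l' l <= 0 ->
  contractible l' -> contractible l.
Proof.
move=> r8 lL lL' d; have [[ll lK] [ll' lK']] := (lL, lL').
have dge := line_dot_ge _ _ r8 lL' lL.
have [dN1|d0] : dot l' l = - 1 \/ dot l' l = 0 by lia.
  by rewrite (line_dot_eqN1 _ _ r8 lL' lL dN1).
apply: (contractible_reflection (l' - l)).
  by split; rewrite !dotE ?(dotC l l'); lia.
by rewrite /reflection !dotE ll' d0 subr0 scaleN1r opprB addrC subrK.
Qed.

(** The map induced on lines of S_8 by the Bertini involution. *)
Definition bertini (l : Pic 8) : Pic 8 := - (2 *: canonical_class 8) - l.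

Lemma bertini_line (l : Pic 8) : line 8 l -> line 8 (bertini l).
Proof.
move=> [ll lK]; have KK := dot_canonicalK 8.
by split; rewrite !dotE ?(dotC (canonical_class 8) l); lia.
Qed.

(** Since l + K is a root with l . (l + K) = - 2, its reflection sends l to
    l - 2 (l + K). *)
Lemma contractible_bertini (l : Pic 8) : line 8 l ->
  contractible l -> contractible (bertini l).
Proof.
move=> [ll lK]; have KK := dot_canonicalK 8.
apply: (contractible_reflection (l + canonical_class 8)).
  by split; rewrite !dotE ?(dotC (canonical_class 8) l); lia.
rewrite /reflection !dotE ll lK /bertini; move: (canonical_class 8) => K.
by apply/rowP => j; rewrite !mxE; move: (l 0 j) (K 0 j) => x y; lia.
Qed.

(** When l' . l >= 2, replacing l' by its Bertini image gives intersection
    2 - l' . l <= 0. *)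
Lemma contractible_line8 (l l' : Pic 8) : line 8 l -> line 8 l' ->
  dot l' l <> 1 -> contractible l' -> contractible l.
Proof.
move=> lL lL' d1 cl'.
have [d0|d2] : dot l' l <= 0 \/ 2 <= dot l' l by lia.
  exact: contractible_dot_le0 cl'.
apply: contractible_dot_le0 (contractible_bertini _ lL' cl') => //.
  exact: bertini_line.
by rewrite !dotE dotC (proj2 lL); lia.
Qed.

Lemma dot_recr {r : nat} (D E : Pic r.+1) :
  dot D E = dot (col' ord_max D) (col' ord_max E) - D 0 ord_max * E 0 ord_max.
Proof.
rewrite /dot big_ord_recr /= !mxE opprD addrA.
have lift00 : lift ord_max (0 : 'I_r.+1) = 0 :> 'I_r.+2 by apply: val_inj.
have liftS (i : 'I_r) : lift (0 : 'I_r.+2) (widen_ord (leqnSn r) i)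
    = lift ord_max (lift (0 : 'I_r.+1) i).
  by apply: val_inj; rewrite /= /bump /= leqNgt ltnS ltn_ord.
have -> : lift (0 : 'I_r.+2) (ord_max : 'I_r.+1) = ord_max by apply: val_inj.
rewrite lift00; congr (_ - _ - _); apply: eq_bigr => i _.
by rewrite liftS !mxE.
Qed.

(** The pullback of classes along the blow-up of one more point, the new
    exceptional class being the last one. *)
Definition pad {r : nat} (D : Pic r) : Pic r.+1 :=
  \row_j (if unlift ord_max j is Some k then D 0 k else 0).

Lemma pad_lift {r : nat} (D : Pic r) (k : 'I_r.+1) :
  pad D 0 (lift ord_max k) = D 0 k.
Proof. by rewrite mxE liftK. Qed.

Lemma col'_pad {r : nat} (D : Pic r) : col' ord_max (pad D) = D.
Proof. by apply/rowP => i; rewrite mxE pad_lift. Qed.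

Lemma pad_max {r : nat} (D : Pic r) : pad D 0 ord_max = 0.
Proof. by rewrite mxE unlift_none. Qed.

Lemma pad_is_zmod_morphism {r : nat} : zmod_morphism (@pad r).
Proof.
by move=> D E; apply/rowP => j; rewrite !mxE; case: unlift => [k|]; rewrite ?mxE ?subr0.
Qed.

HB.instance Definition _ (r : nat) :=
  GRing.isZmodMorphism.Build (Pic r) (Pic r.+1) (@pad r) pad_is_zmod_morphism.

Definition exceptional {r : nat} (i : 'I_r) : Pic r := delta_mx 0 (lift 0 i).

Lemma dot_exceptional {r : nat} (D : Pic r) (i : 'I_r) :
  dot D (exceptional i) = - D 0 (lift 0 i).
Proof.
rewrite /dot (bigD1 i) //= big1 => [|j ji]; rewrite !mxE !eqxx /=.
  by lia.
by rewrite (inj_eq lift_inj) (negbTE ji) mulr0.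
Qed.

Lemma exceptional_line {r : nat} (i : 'I_r) : line r (exceptional i).
Proof.
by split; [|rewrite dotC]; rewrite dot_exceptional !mxE //= !eqxx.
Qed.

Lemma exceptional_max_contractible (r : nat) :
  contractible (exceptional (ord_max : 'I_r.+1)).
Proof.
exists (@pad r : {additive _ -> _}).
have lmax : lift 0 (ord_max : 'I_r.+1) = ord_max by apply: val_inj.
split=> [D E||D|D] /=.
- by rewrite dot_recr !col'_pad !pad_max mulr0 subr0.
- apply/rowP => j; case: (unliftP ord_max j) => [k ->|->].
    rewrite [RHS]mxE pad_lift !mxE /= lmax [_ == ord_max]eq_sym.
    rewrite (negbTE (neq_lift _ _)) addr0.
    by rewrite -!val_eqE /= /bump leqNgt ltn_ord.
  by rewrite [RHS]mxE pad_max !mxE /= lmax !eqxx.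
- by rewrite dot_exceptional lmax pad_max oppr0.
- exists (col' ord_max D), (D 0 ord_max); apply/rowP => j.
  rewrite [RHS]mxE; case: (unliftP ord_max j) => [k ->|->].
    rewrite pad_lift !mxE /= lmax [_ == ord_max]eq_sym.
    by rewrite (negbTE (neq_lift _ _)) mulr0 addr0.
  by rewrite pad_max !mxE lmax !eqxx mulr1 add0r.
Qed.

(** Some e_i has intersection different from 1 with l, and e_i is reached from
    e_8, which it equals or does not meet. *)
Lemma line8_contractible (l : Pic 8) : line 8 l -> contractible l.
Proof.
move=> lL; have [i di] : exists i, dot (exceptional i) l <> 1.
  (* Otherwise l = d h - (e_1 + ... + e_8): l . K = - 1 forces d = 3, and then *)
  (* l . l = 9 - 8 is not - 1. *)
  apply: contrapT => /forallNP d1.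
  have li i : l 0 (lift 0 i) = - 1.
    by have /contrapT := d1 i; rewrite dotC dot_exceptional => <-; rewrite opprK.
  have [] := lL; rewrite dot_canonical /dot.
  under eq_bigr do rewrite li.
  under [X in _ -> - (_ + X) = _ -> _]eq_bigr do rewrite li.
  rewrite !sumr_const !card_ord => dd dK.
  have d3 : l 0 0 = 3 by lia.
  by move: dd; rewrite d3.
apply: contractible_line8 (exceptional_line i) di _ => //.
apply: contractible_line8 (exceptional_line _) _ (exceptional_max_contractible 7).
  exact: exceptional_line.
by rewrite dot_exceptional mxE; case: (_ && _).
Qed.

(** * Fixed center *)

(** Here K^2 = 1; l1 + l2 + 2K is a root, and lines of S_8 are the classes
    a - K with a a root. *)
Lemma center_line (l1 l2 : Pic 8) : line 8 l1 -> line 8 l2 -> dot l1 l2 = 2 ->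
  line 8 (l1 + l2 + canonical_class 8).
Proof.
move=> [l11 l1K] [l22 l2K] d; have KK := dot_canonicalK 8.
by split; rewrite !dotE ?(dotC l2 l1) ?(dotC (canonical_class 8) l1)
  ?(dotC (canonical_class 8) l2); lia.
Qed.

Lemma blow_down_line {r : nat} (l : Pic r.+1) (p : {additive Pic r -> Pic r.+1})
    (E : Pic r) : blow_down l p -> line r.+1 (p E) <-> line r E.
Proof. by move=> [pd pK pl _]; rewrite /line /= pK dotDr pl !pd addr0. Qed.

(** In D = p E + m l the coefficient m is - D . l. *)
Lemma blow_down_orth {r : nat} (l : Pic r.+1) (p : {additive Pic r -> Pic r.+1})
    (D : Pic r.+1) : blow_down l p -> line r.+1 l -> dot D l = 0 ->
  exists E, D = p E.
Proof.
move=> [_ _ pl pdec] [ll _] Dl; have [E [m Em]] := pdec D; exists E.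
move: Dl; rewrite Em !dotE pl ll => m0.
by rewrite (_ : m = 0) ?scale0r ?addr0 //; lia.
Qed.

(** The line l = c + K is orthogonal to both lines of each pair of center c, so
    that these come from S_7. Conversely all pairs on S_7 have sum - K_7, whose
    pullback is l - K_8 = c. *)
Lemma configuration_pullback (c : Pic 8) (p : {additive Pic 7 -> Pic 8}) :
  line 8 (c + canonical_class 8) -> blow_down (c + canonical_class 8) p ->
  configuration (A1_polytopes_at c) = pullback_family p (S_A2 7).
Proof.
set l := c + _ => lL bp; have [pd pK pl _] := bp.
rewrite eqEsubset; split=> A.
  case/(configuration_A1_at c A (leqnn 8)) => l1 [l2 [l1L l2L d lc ->]].
  have [[l11 l1K] [l22 l2K]] := (l1L, l2L).
  have [E1 E1p] : exists E, l1 = p E.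
    by apply: blow_down_orth bp lL _; rewrite /l -lc !dotE; lia.
  have [E2 E2p] : exists E, l2 = p E.
    by apply: blow_down_orth bp lL _; rewrite /l -lc !dotE (dotC l2 l1); lia.
  subst l1 l2.
  exists [fset E1; E2]%fset.
    exists E1, E2; split=> //; last by rewrite -d pd.
      exact/(blow_down_line _ _ _ bp).
    exact/(blow_down_line _ _ _ bp).
  by rewrite imfset2.
move=> [_ [E1 [E2 [E1L E2L d ->]]] <-].
apply/(configuration_A1_at c _ (leqnn 8)); exists (p E1), (p E2); split.
- exact/(blow_down_line _ _ _ bp).
- exact/(blow_down_line _ _ _ bp).
- by rewrite pd.
- rewrite -raddfD (line7_dot2 _ _ E1L E2L d) raddfN.
  have -> : p (canonical_class 7) = canonical_class 8 - l by rewrite pK addrK.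
  by rewrite /l opprB addrK.
- by rewrite imfset2.
Qed.

Theorem theorem31 :
  steiner_system 2 (S_A2 7) /\
  configuration (A1_polytopes 7) = S_A2 7 /\
  (forall c : Pic 8, A1_polytopes_at c !=set0 ->
     exists l : Pic 8,
       [/\ line 8 l,
           exists p : {additive Pic 7 -> Pic 8}, blow_down l p
         & forall p : {additive Pic 7 -> Pic 8}, blow_down l p ->
             configuration (A1_polytopes_at c) = pullback_family p (S_A2 7)]).
Proof.
split; first exact: S_A2_steiner.
split; first exact: configuration_A1.
move=> c [_ [l1 [l2 [[l1L l2L d _ _] lc]]]].
have lL : line 8 (c + canonical_class 8) by rewrite -lc; apply: center_line.
exists (c + canonical_class 8); split=> //; first exact: line8_contractible.
by move=> p; apply: configuration_pullback.
Qed.
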